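(* Let $d$ be a positive integer and let $D=d$ if $d$ is even and $D=d+1$ if $d$ is odd. Let $(t_0,\dots,t_{d-1})\in\mathbb{C}^d$ be arbitrary. Then, for every polynomial $f=\sum_\nu a_\nu X^\nu\in\mathbb{C}[X]$ of degree $<d$ with $\|f\|_\infty\le 1$, one has $$|t_0a_0+\dots+t_{d-1}a_{d-1}|\le\frac1D\sum_{\omega^D=1}\left|\sum_{\nu=0}^{d-1}\frac{t_\nu}{\omega^\nu}\right|.$$
   Context: For a function $f$ on the open complex unit disk $\mathbb{D}$, $\|f\|_\infty=\sup\{|f(z)|: z\in\mathbb{D}\}$. The sum $\sum_{\omega^D=1}$ ranges over all complex numbers $\omega$ with $\omega^D=1$. *)

(* Defs.v *)
From HB Require Import structures.
From mathcomp Require Import all_boot all_order all_algebra.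
From mathcomp Require Import all_classical all_reals ereal.
From mathcomp Require Export complex.

Set Implicit Arguments.
Unset Strict Implicit.
Unset Printing Implicit Defensive.

Import Order.TTheory GRing.Theory Num.Theory.
Import ComplexField.Normc.

Local Open Scope classical_set_scope.
Local Open Scope ring_scope.
Local Open Scope complex_scope.

(* [normc] is the R-valued modulus; the ring norm on R[i] takes values in
   R[i]. *)
Definition unit_disk (R : realType) : set R[i] := [set z | normc z < 1].

(* Extended-real valued, so that unbounded functions get norm +oo. *)
Definition disk_norm (R : realType) (f : R[i] -> R[i]) : \bar R :=
  ereal_sup [set (normc (f z))%:E | z in @unit_disk R].

Definition next_even (d : nat) : nat := if odd d then d.+1 else d.

(* Main.v *)
Require Import Defs.
From HB Require Import structures.
From mathcomp Require Import all_boot all_order all_algebra.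
From mathcomp Require Import all_classical all_reals ereal.
From mathcomp Require Import separable cyclic cyclotomic.

Set Implicit Arguments.
Unset Strict Implicit.
Unset Printing Implicit Defensive.

Import Order.TTheory GRing.Theory Num.Theory.
Import ComplexField.Normc.

Local Open Scope classical_set_scope.
Local Open Scope ring_scope.
Local Open Scope complex_scope.

(** A polynomial of degree less than d <= n is recovered from its values at the
    n-th roots of unity by the inverse discrete Fourier transform.  Hence the
    linear functional of its coefficients with weights t is the average, over
    these roots w, of f(w) times the sum of the t_nu / w^nu
    ([sum_prim_root_pairing]).  The bound on f over the open disk passes to the
    unit circle by continuity ([poly_le_closed_disk]), so each factor f(w) has
    modulus at most 1, and the triangle inequality bounds the average. *)

(** The roots of X^n - 1 are n distinct roots of unity, because this polynomial
    is separable when n is invertible; such a family in a field always contains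
    a primitive one. *)
Lemma closed_prim_root_exists (F : closedFieldType) (n : nat) :
  n%:R != 0 :> F -> exists z : F, n.-primitive_root z.
Proof.
move=> n_neq0; have n_gt0 : (0 < n)%N by case: n n_neq0; rewrite ?eqxx.
have [rs def_p] := closed_field_poly_normal ('X^n - 1 : {poly F}).
have p_monic := monicXnsubC (1 : F) n_gt0.
rewrite (monicP p_monic) scale1r in def_p.
have rs_uniq : uniq rs.
  by rewrite -separable_prod_XsubC -def_p separable_Xn_sub_1.
have rs_unity : all n.-unity_root rs.
  by apply/allP=> x; rewrite -root_prod_XsubC -def_p.
have : (n <= size rs)%N.
  rewrite -ltnS -(size_prod_XsubC rs id) -def_p.
  by rewrite -[1 in X in size X](polyC1) size_XnsubC.
by move/(has_prim_root n_gt0 rs_unity rs_uniq)/hasP => [z _ zP]; exists z.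
Qed.

(** The summand is the i-th power of x = z^j / z^k, an n-th root of unity that is
    1 only if j = k; otherwise the geometric sum is (x^n - 1) / (x - 1) = 0. *)
Lemma sum_prim_root_expr (F : fieldType) (n : nat) (z : F) (j k : 'I_n) :
  n.-primitive_root z ->
  \sum_(i < n) (z ^+ i) ^+ j / (z ^+ i) ^+ k = n%:R *+ (j == k).
Proof.
move=> z_prim; have n_gt0 := prim_order_gt0 z_prim.
have zk_neq0 : z ^+ k != 0.
  apply: expf_neq0; apply/eqP=> z0; have := prim_expr_order z_prim.
  by move/eqP; rewrite z0 expr0n eqn0Ngt n_gt0 eq_sym oner_eq0.
pose x := z ^+ j / z ^+ k.
rewrite (eq_bigr (fun i : 'I_n => x ^+ i)) => [|i _]; last first.
  by rewrite /x expr_div_n -!exprM ![(i * _)%N]mulnC.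
have [eq_jk | neq_jk] := eqVneq j k; rewrite ?mulr1n ?mulr0n.
  rewrite (eq_bigr (fun=> 1)) ?sumr_const ?card_ord // => i _.
  by rewrite /x eq_jk divff ?expr1n.
have x_neq1 : x - 1 != 0.
  rewrite subr_eq0; apply: contra neq_jk => /eqP x1.
  have : z ^+ j == z ^+ k by rewrite -[z ^+ j](divfK zk_neq0) -/x x1 mul1r.
  by rewrite (eq_prim_root_expr z_prim) !modn_small.
apply: (mulfI x_neq1); rewrite -subrX1 mulr0 /x expr_div_n -!exprM.
rewrite ![(_ * n)%N]mulnC !exprM (prim_expr_order z_prim) !expr1n.
by rewrite divr1 subrr.
Qed.

(** Expanding f over its coefficients reduces this to the orthogonality of the
    characters of the group of n-th roots of unity. *)
Lemma sum_prim_root_pairing (F : fieldType) (n d : nat) (z : F)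
    (t : 'I_d -> F) (f : {poly F}) :
  n.-primitive_root z -> (d <= n)%N -> (size f <= d)%N ->
  \sum_(i < n) (\sum_(nu < d) t nu / (z ^+ i) ^+ nu) * f.[z ^+ i] =
    n%:R * \sum_(nu < d) t nu * f`_nu.
Proof.
move=> z_prim le_dn size_f.
under eq_bigr => i _ do rewrite mulr_suml.
rewrite exchange_big mulr_sumr; apply: eq_bigr => nu _ /=.
under eq_bigr => i _ do rewrite (horner_coef_wide _ size_f) mulr_sumr.
rewrite exchange_big /= (bigD1 nu) //= [X in _ + X]big1 => [|m neq_m].
  have := sum_prim_root_expr (widen_ord le_dn nu) (widen_ord le_dn nu) z_prim.
  rewrite eqxx mulr1n addr0 mulrC => <-; rewrite mulr_sumr.
  by apply: eq_bigr => i _ /=; rewrite mulrACA [_^-1 * _]mulrC.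
have := sum_prim_root_expr (widen_ord le_dn m) (widen_ord le_dn nu) z_prim.
rewrite -val_eqE /= val_eqE (negPf neq_m) mulr0n => sum0.
transitivity (t nu * f`_m * 0); last exact: mulr0.
rewrite -[X in _ * X]sum0 mulr_sumr; apply: eq_bigr => i _ /=.
by rewrite mulrACA [_^-1 * _]mulrC.
Qed.

Lemma normc_ge0 (R : rcfType) (x : R[i]) : 0 <= normc x.
Proof. by case: x => a b; exact: sqrtr_ge0. Qed.

Lemma normc_real (R : rcfType) (r : R) : 0 <= r -> normc r%:C = r.
Proof.
by move=> r_ge0; rewrite /normc /= expr0n addr0 sqrtr_sqr ger0_norm.
Qed.

Lemma normcX (R : rcfType) (x : R[i]) (n : nat) :
  normc (x ^+ n) = normc x ^+ n.
Proof.
elim: n => [|n IHn]; first by rewrite !expr0 normc1.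
by rewrite !exprS normcM IHn.
Qed.

Lemma normc_sum (R : rcfType) (I : Type) (r : seq I) (F : I -> R[i]) :
  normc (\sum_(i <- r) F i) <= \sum_(i <- r) normc (F i).
Proof.
apply: (big_ind2 (fun x y => normc x <= y)) => // [|x1 x2 y1 y2 le1 le2].
  by rewrite normc0.
exact: le_trans (le_normcD _ _) (lerD le1 le2).
Qed.

(** By the factor theorem f - f(w) = q * (X - w), and q is bounded on the disk,
    so |f(w)| exceeds |f(r w)| by at most a constant times 1 - r. *)
Lemma poly_le_closed_disk (R : rcfType) (f : {poly R[i]}) (B : R) :
  (forall x, normc x < 1 -> normc f.[x] <= B) ->
  forall w, normc w <= 1 -> normc f.[w] <= B.
Proof.
move=> f_le w w_le1.
have [q def_q] : exists q, f - f.[w]%:P = q * ('X - w%:P).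
  by apply/factor_theorem; rewrite rootE !hornerE subrr.
have [ub ubP] := poly_disk_bound q 1.
have [M M_ge0 q_le] : exists2 M, 0 <= M
    & forall x, normc x <= 1 -> normc q.[x] <= M.
  have q_le x : normc x <= 1 -> normc q.[x] <= complex.Re ub.
    move=> x_le1; have : `|q.[x]| <= ub by apply: ubP; rewrite lecR.
    by rewrite lecE => /andP[_].
  exists (complex.Re ub) => //.
  by apply: le_trans (q_le 0 _); rewrite ?normc_ge0 ?normc0.
apply/ler_addgt0Pr => e e_gt0.
(* This s lies in ]0, 1] even when M = 0, and s * M <= e. *)
pose s := e / (M + e).
have Me_gt0 : 0 < M + e by rewrite ltr_wpDl.
have s_gt0 : 0 < s by rewrite divr_gt0.
have s_le1 : s <= 1 by rewrite ler_pdivrMr // mul1r lerDr.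
have sM_le : s * M <= e.
  by rewrite /s mulrAC ler_pdivrMr // ler_pM2l // lerDl ltW.
have sw_lt1 : normc ((1 - s)%:C * w) < 1.
  rewrite normcM normc_real ?subr_ge0 //.
  apply: le_lt_trans (_ : 1 - s < 1); last by rewrite ltrBlDr ltrDl.
  by rewrite ler_piMr // subr_ge0.
have -> : f.[w] = f.[(1 - s)%:C * w] + q.[(1 - s)%:C * w] * (s%:C * w).
  have -> : s%:C * w = - ((1 - s)%:C * w - w).
    by rewrite rmorphB rmorph1 mulrBl mul1r opprB opprB addrC subrK.
  have := congr1 (fun p => p.[(1 - s)%:C * w]) def_q.
  rewrite !hornerE => def_qx.
  by rewrite mulrN -def_qx opprB addrC subrK.
apply: le_trans (le_normcD _ _) _; apply: lerD (f_le _ sw_lt1) _.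
apply: le_trans sM_le; rewrite !normcM normc_real ?(ltW s_gt0) // mulrC.
apply: ler_pM (q_le _ (ltW sw_lt1)); rewrite ?normc_ge0 //.
  by rewrite mulr_ge0 ?normc_ge0 ?(ltW s_gt0).
by rewrite ler_piMr ?(ltW s_gt0).
Qed.

Lemma fsbig_unity_roots (F : fieldType) (V : nmodType) (n : nat) (z : F)
    (G : F -> V) : n.-primitive_root z ->
  \sum_(w \in [set w : F | w ^+ n = 1]) G w = \sum_(i < n) G (z ^+ i).
Proof.
move=> z_prim; pose rs := [seq z ^+ i | i : 'I_n <- enum 'I_n].
have rs_uniq : uniq rs.
  rewrite map_inj_uniq ?enum_uniq // => i j /eqP.
  by rewrite (eq_prim_root_expr z_prim) !modn_small // => /eqP /val_inj.
have -> : [set w : F | w ^+ n = 1] = [set` rs].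
  apply/seteqP; split=> w /=.
    move/(prim_rootP z_prim) => [i ->].
    by apply/mapP; exists i; rewrite ?mem_enum.
  by case/mapP=> i _ ->; rewrite exprAC (prim_expr_order z_prim) expr1n.
by rewrite -fsbig_seq // big_map big_enum.
Qed.

Theorem corollary2p8 (R : realType) (d : nat) (hd : (0 < d)%N)
    (t : 'I_d -> R[i]) (f : {poly R[i]}) (hdeg : (size f <= d)%N)
    (hf : (disk_norm (horner f) <= 1)%E) :
  let D := next_even d in
  normc (\sum_(nu < d) t nu * f`_nu) <=
    (D%:R)^-1 * \sum_(w \in [set w : R[i] | w ^+ D = 1])
                  normc (\sum_(nu < d) t nu / w ^+ nu).
Proof.
cbv zeta; set D := next_even d.
have le_dD : (d <= D)%N by rewrite /D /next_even; case: ifP.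
have D_gt0 : (0 < D)%N by apply: leq_trans le_dD.
have D_neq0 : D%:R != 0 :> R[i] by rewrite pnatr_eq0 -lt0n.
have [z z_prim] := closed_prim_root_exists D_neq0.
have f_le1 : forall x, normc x <= 1 -> normc f.[x] <= 1.
  apply: poly_le_closed_disk => x x_lt1; rewrite -lee_fin.
  by apply: le_trans hf; apply: ereal_sup_ubound; exists x.
rewrite (fsbig_unity_roots _ z_prim) ler_pdivlMl ?ltr0n //.
have normcD : normc (D%:R : R[i]) = D%:R.
  by rewrite -(rmorph_nat (real_complex R)) normc_real.
rewrite -[X in X * _]normcD -normcM.
rewrite -(sum_prim_root_pairing t z_prim le_dD hdeg).
apply: le_trans (normc_sum _ _) _; apply: ler_sum => i _.
have norm_zi : normc (z ^+ i) = 1.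
  have : normc z == 1.
    rewrite -(pexpr_eq1 D_gt0) ?normc_ge0 // -normcX.
    by rewrite (prim_expr_order z_prim) normc1.
  by rewrite normcX => /eqP ->; rewrite expr1n.
by rewrite normcM ler_piMr ?normc_ge0 ?f_le1 ?norm_zi.
Qed.
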